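(* There is an absolute constant $C>0$ such that the following holds. Let $G$ be a general two-prover game on a bi-regular bipartite graph $((X,Y),E)$, and let $\epsilon,\delta>0$. Let $H_1=((W,X),E_1)$ and $H_2=((Z,Y),E_2)$ be left-regular bipartite graphs that are both $(\delta,\epsilon,\epsilon)$-fortifiers. Then the concatenated game $G^*=H_1\circ G\circ H_2$ is $(\delta,C\epsilon)$-robust.
   Context: A (general) two-prover game is given by a bipartite (multi)graph $((X,Y),E)$, alphabets $\Sigma_X,\Sigma_Y$, and for each edge $e=(x,y)$ a constraint $\psi_e\subseteq\Sigma_X\times\Sigma_Y$. Its value $\mathrm{val}(G)$ is the maximum, over labellings $L_X:X\to\Sigma_X$, $L_Y:Y\to\Sigma_Y$, of the fraction of edges $(x,y)$ (counted with multiplicity, i.e. a uniformly random edge) with $(L_X(x),L_Y(y))\in\psi_{(x,y)}$. For $S\subseteq X$, $T\subseteq Y$, $G_{S\times T}$ is the game in which the verifier picks a uniformly random edge $(x,y)\in E$ conditioned on $x\in S$, $y\in T$ (i.e. the game restricted to the edges between $S$ and $T$). $G$ is $(\delta,\epsilon)$-robust if for all $S\subseteq X$, $T\subseteq Y$ with $|S|\ge\delta|X|$ and $|T|\ge\delta|Y|$, $\mathrm{val}(G_{S\times T})\le\mathrm{val}(G)+\epsilon$. Concatenation: if $H_1=((W,X),E_1)$ has left-degree $D_1$ and $H_2=((Z,Y),E_2)$ has left-degree $D_2$, the game $H_1\circ G\circ H_2$ is played on a bipartite multigraph on $(W,Z)$ with alphabets $\Sigma_W=\Sigma_X^{D_1}$,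 $\Sigma_Z=\Sigma_Y^{D_2}$; a label of $w\in W$ is viewed as an assignment of labels in $\Sigma_X$ to the $D_1$ neighbours of $w$ in $H_1$ (in a fixed order), and similarly for $z\in Z$. For every $(w,x)\in E_1$, $(x,y)\in E$, $(z,y)\in E_2$ there is an edge $(w,z)$ whose constraint reads off the label of $x$ from the label of $w$ and the label of $y$ from the label of $z$ and checks $\psi_{(x,y)}$. Fortifier: a bipartite graph $H=((W,X),E_H)$ is a $(\delta,\epsilon_1,\epsilon_2)$-fortifier if for every $S\subseteq W$ with $|S|\ge\delta|W|$, the distribution $\pi$ on $X$ obtained by choosing $w\in S$ uniformly and then a uniformly random neighbour $x$ of $w$ satisfies $\sum_{x}|\pi(x)-1/|X||\le\epsilon_1$ and $\sum_x(\pi(x)-1/|X|)^2\le\epsilon_2/|X|$. *)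

(* Defs.v *)
From HB Require Import structures.
From mathcomp Require Import all_boot all_order all_algebra.
From mathcomp Require Import reals.

Set Implicit Arguments.
Unset Strict Implicit.
Unset Printing Implicit Defensive.

Import Order.TTheory GRing.Theory Num.Theory.
Local Open Scope ring_scope.

(* The edges form a type of their own, so that parallel edges, possibly with
   different constraints, are allowed. *)
Record game (X Y A B : finType) := Game {
  edge : finType;
  left_end : edge -> X;
  right_end : edge -> Y;
  constraint : edge -> {set A * B}
}.

Section Games.
Variables (R : realType) (X Y A B : finType).
Implicit Type G : game X Y A B.

Definition satisfied G (L : {ffun X -> A} * {ffun Y -> B}) : {set edge G} :=
  [set e | (L.1 (left_end e), L.2 (right_end e)) \in constraint e].

(* A game without edges has value 0. *)
Definition game_val G : R :=
  \big[Num.max/0]_(L : {ffun X -> A} * {ffun Y -> B})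
    (#|satisfied G L|%:R / #|edge G|%:R).

Definition restrict G (S : {set X}) (T : {set Y}) : game X Y A B :=
  @Game X Y A B {e : edge G | (left_end e \in S) && (right_end e \in T)}
    (fun e => left_end (sval e)) (fun e => right_end (sval e))
    (fun e => constraint (sval e)).

Definition robust (delta eps : R) G : Prop :=
  forall (S : {set X}) (T : {set Y}),
    delta * #|X|%:R <= #|S|%:R -> delta * #|Y|%:R <= #|T|%:R ->
    game_val (restrict G S T) <= game_val G + eps.

Definition biregular G : Prop :=
  exists dX dY : nat,
    (forall x : X, #|[set e : edge G | left_end e == x]| = dX) /\
    (forall y : Y, #|[set e : edge G | right_end e == y]| = dY).

End Games.

Section BipartiteGraphs.
Variables (R : realType) (W X : finType).
Implicit Type H : {set W * X}.

Definition nbrs H (w : W) : {set X} := [set x | (w, x) \in H].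

Definition left_regular H (D : nat) : Prop := forall w : W, #|nbrs H w| = D.

Definition nbr_dist H (S : {set W}) (x : X) : R :=
  \sum_(w in S) #|S|%:R^-1 * (if x \in nbrs H w then #|nbrs H w|%:R^-1 else 0).

Definition fortifier (delta eps1 eps2 : R) H : Prop :=
  forall S : {set W}, delta * #|W|%:R <= #|S|%:R ->
    \sum_(x : X) `|nbr_dist H S x - #|X|%:R^-1| <= eps1 /\
    \sum_(x : X) (nbr_dist H S x - #|X|%:R^-1) ^+ 2 <= eps2 / #|X|%:R.

(* The position of x among the D neighbours of w, listed in the order of
   enum X. *)
Definition nbr_index H D (regH : left_regular H D) (w : W) (x : X)
    (wx : (w, x) \in H) : 'I_D :=
  cast_ord (regH w) (enum_rank_in (etrans (in_set _ x) wx : x \in nbrs H w) x).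

End BipartiteGraphs.

Section Concatenation.
Variables (X Y A B W Z : finType).

(* (w, x) and (z, y) are determined by w, z and the edge e = (x, y) of G, so
   the edges of the concatenated game are triples (w, e, z). *)
Definition concat_edge (G : game X Y A B) (H1 : {set W * X}) (H2 : {set Z * Y})
    : finType :=
  {t : W * edge G * Z |
    ((t.1.1, left_end t.1.2) \in H1) && ((t.2, right_end t.1.2) \in H2)}.

Definition concat (G : game X Y A B) (H1 : {set W * X}) (H2 : {set Z * Y})
    (D1 D2 : nat) (reg1 : left_regular H1 D1) (reg2 : left_regular H2 D2) :
    game W Z (D1.-tuple A) (D2.-tuple B) :=
  @Game W Z (D1.-tuple A) (D2.-tuple B) (concat_edge G H1 H2)
    (fun t => (sval t).1.1) (fun t => (sval t).2)
    (fun t =>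
      let i := nbr_index reg1 (proj1 (andP (svalP t))) in
      let j := nbr_index reg2 (proj2 (andP (svalP t))) in
      [set ab | (tnth ab.1 i, tnth ab.2 j) \in constraint (sval t).1.2]).

End Concatenation.

(* Main.v *)
Require Import Defs.
From mathcomp Require Import all_boot all_order all_algebra.
From mathcomp Require Import reals ring lra.

Set Implicit Arguments.
Unset Strict Implicit.
Unset Printing Implicit Defensive.

Import Order.TTheory GRing.Theory Num.Theory.
Local Open Scope ring_scope.

(** Restricting the concatenated game to [S] and [T] weights an edge [(x, y)] of
    [G] proportionally to [pi(x) rho(y)], where [pi] and [rho] are the neighbour
    distributions of [S] and [T].  Writing [|X| pi = 1 + alpha] and
    [|Y| rho = 1 + beta], the weight [(1 + alpha)(1 + beta)] is within
    [2 eps1 + eps2] of 1 on average: biregularity transports the [L1] and [L2]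
    bounds to the edges, and AM-GM controls the product [alpha beta].  Hence
    making the edge distribution uniform changes the success rate of a strategy
    by at most [2 eps1 + eps2].  Labels of the restricted game give a mixed
    strategy for [G] (each [x] asks a random neighbour in [S]), which some pure
    strategy matches, and labels of [G] carry over to the concatenated game; so
    the values of the restricted game, and of the concatenated game itself, are
    within [2 eps1 + eps2] of the value of [G]. *)

Section WeightedMean.
Variables (R : realFieldType) (I : finType).
Implicit Types (mu nu s : I -> R) (U : {set I}).

(* When the total weight is 0 this is 0, which still lies between the bounds
   of a function [s] with values in [0, 1]. *)
Definition wmean mu s : R := (\sum_i mu i * s i) / \sum_i mu i.

Definition indic U (i : I) : R := (i \in U)%:R.

Lemma indic_ge0 U i : 0 <= indic U i.
Proof. exact: ler0n. Qed.

Lemma eq_wmean mu nu s : mu =1 nu -> wmean mu s = wmean nu s.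
Proof.
by move=> mu_nu; congr (_ / _); apply: eq_bigr => i _; rewrite mu_nu.
Qed.

Lemma wmean_scale (c : R) mu s :
  (c = 0 -> forall i, mu i = 0) -> wmean (fun i => c * mu i) s = wmean mu s.
Proof.
have [-> mu0|c0 _] := eqVneq c 0.
  by rewrite /wmean !big1 // => i _; rewrite mu0 // !mul0r.
rewrite /wmean -mulr_sumr; under eq_bigr do rewrite -mulrA.
by rewrite -mulr_sumr -mulf_div divff // mul1r.
Qed.

Lemma wmean_mul_weight mu s :
  (forall i, 0 <= mu i) -> wmean mu s * (\sum_i mu i) = \sum_i mu i * s i.
Proof.
move=> mu0; have [M0|M0] := eqVneq (\sum_i mu i) 0; last exact: divfK.
rewrite M0 mulr0 big1 // => i _.
by rewrite (psumr_eq0P _ M0) ?mul0r.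
Qed.

Lemma wmean_ge0 mu s :
  (forall i, 0 <= mu i) -> (forall i, 0 <= s i) -> 0 <= wmean mu s.
Proof.
by move=> mu0 s0; rewrite divr_ge0 ?sumr_ge0 // => i _; rewrite mulr_ge0.
Qed.

Lemma wmean_le mu s (c : R) :
  0 <= c -> (forall i, 0 <= mu i) -> (forall i, s i <= c) -> wmean mu s <= c.
Proof.
move=> c0 mu0 sc; have [M0|] := eqVneq (\sum_i mu i) 0.
  by rewrite /wmean M0 invr0 mulr0.
rewrite neq_lt ltNge sumr_ge0 //= => M0.
by rewrite ler_pdivrMr // mulr_sumr ler_sum // => i _; rewrite mulrC ler_wpM2r.
Qed.

Lemma wmean_sum (J : finType) (P : pred J) mu (F : J -> I -> R) :
  \sum_(j | P j) wmean mu (F j) = wmean mu (fun i => \sum_(j | P j) F j i).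
Proof.
rewrite -mulr_suml exchange_big; congr (_ / _).
by apply: eq_bigr => i _; rewrite mulr_sumr.
Qed.

Lemma wmean_uniform s : wmean (fun=> 1) s = (\sum_i s i) / #|I|%:R.
Proof. by rewrite /wmean sumr_const; under eq_bigr do rewrite mul1r. Qed.

Lemma card_mul_wmean_indic U s :
  #|U|%:R * wmean (indic U) s = \sum_(i in U) s i.
Proof.
have sum_indic t : \sum_i indic U i * t i = \sum_(i in U) t i.
  by rewrite [RHS]big_mkcond; apply: eq_bigr => i _; rewrite mulr_natl mulrb.
rewrite mulrC -sum_indic -(wmean_mul_weight _ (indic_ge0 U)).
have := sum_indic (fun=> 1); rewrite sumr_const => <-.
by under eq_bigr do rewrite mulr1.
Qed.

(* The [mu]-weighted deviations of [s] from its mean [r] cancel, so the two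
   means differ by the uniform mean of [(mu - 1) (s - r)]. *)
Lemma wmean_close_uniform mu s (c : R) :
  (forall i, 0 <= mu i) -> (forall i, 0 <= s i <= 1) -> 0 <= c ->
  \sum_i `|mu i - 1| <= c * #|I|%:R ->
  `|wmean mu s - wmean (fun=> 1) s| <= c.
Proof.
move=> mu0 s01 c0 muc; rewrite wmean_uniform; set r := wmean mu s.
have r01 : 0 <= r <= 1.
  by rewrite wmean_ge0 ?wmean_le // => i; have /andP[] := s01 i.
have [I0|I0] := posnP #|I|.
  by rewrite /r /wmean !(big_pred0 _ _ _ _ (card0_eq I0)) !mul0r subr0 normr0.
have I_gt0 : 0 < #|I|%:R :> R by rewrite ltr0n.
have -> : r - (\sum_i s i) / #|I|%:R =
          (\sum_i (mu i - 1) * (s i - r)) / #|I|%:R.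
  have -> : \sum_i (mu i - 1) * (s i - r) =
      \sum_i mu i * s i - r * (\sum_i mu i) - (\sum_i s i - r * #|I|%:R).
    have -> : r * #|I|%:R = \sum_(i : I) r by rewrite sumr_const mulr_natr.
    by rewrite mulr_sumr -!sumrB; apply: eq_bigr => i _; ring.
  by rewrite wmean_mul_weight // subrr sub0r opprB mulrBl mulfK // gt_eqF.
rewrite normrM normfV (gtr0_norm I_gt0) ler_pdivrMr //; apply: le_trans muc.
apply: le_trans (ler_norm_sum _ _ _) _; apply: ler_sum => i _.
rewrite normrM ler_piMr // ler_norml.
by move: (s01 i) r01 => /andP[? ?] /andP[? ?]; lra.
Qed.

End WeightedMean.

Section PureChoice.
Variable R : realFieldType.

Lemma pure_choice (E X I : finType) (f : E -> X) (i0 : I)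
    (p : X -> I -> R) (F : E -> I -> R) :
  (forall x i, 0 <= p x i) -> (forall e i, 0 <= F e i) ->
  exists c : X -> I,
    \sum_e wmean (p (f e)) (F e) <= \sum_e F e (c (f e)).
Proof.
move=> p0 F0; pose fibre_sum x i := \sum_(e | f e == x) F e i.
exists (fun x => [arg max_(i > i0) fibre_sum x i]%O).
rewrite !(partition_big f predT) //=; apply: ler_sum => x _.
under eq_bigr => e /eqP-> do []; under [leRHS]eq_bigr => e /eqP-> do [].
rewrite wmean_sum -/(fibre_sum x _); case: arg_maxP => // c _ c_max.
by apply: wmean_le => // [|i]; [apply: sumr_ge0 | apply: c_max].
Qed.

Lemma pure_choice_pair (E X Y I J : finType) (f : E -> X) (g : E -> Y)
    (i0 : I) (j0 : J) (p : X -> I -> R) (q : Y -> J -> R)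
    (F : E -> I -> J -> R) :
  (forall x i, 0 <= p x i) -> (forall y j, 0 <= q y j) ->
  (forall e i j, 0 <= F e i j) ->
  exists (c : X -> I) (d : Y -> J),
    \sum_e wmean (p (f e)) (fun i => wmean (q (g e)) (F e i)) <=
    \sum_e F e (c (f e)) (d (g e)).
Proof.
move=> p0 q0 F0.
have [c c_best] :=
  pure_choice f i0 p0 (fun e i => wmean_ge0 (q0 (g e)) (F0 e i)).
have [d d_best] := pure_choice g j0 q0 (fun e => F0 e (c (f e))).
by exists c, d; apply: le_trans c_best d_best.
Qed.

End PureChoice.

Section RegularMap.
Variables (R : realFieldType) (E V : finType) (f : E -> V) (d : nat).
Hypothesis card_fibre : forall v, #|[set e | f e == v]| = d.

Lemma sum_comp_regular (F : V -> R) : \sum_e F (f e) = d%:R * \sum_v F v.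
Proof.
rewrite (partition_big f predT) //= mulr_sumr; apply: eq_bigr => v _.
rewrite -(card_fibre v) cardsE mulr_natl -sumr_const.
by apply: eq_big => // e /eqP->.
Qed.

Lemma card_regular_dom : #|E|%:R = d%:R * #|V|%:R :> R.
Proof. by have := sum_comp_regular (fun=> 1); rewrite !sumr_const. Qed.

Lemma density_sub1 (a : V -> R) e :
  #|V|%:R * a (f e) - 1 = #|V|%:R * (a (f e) - #|V|%:R^-1).
Proof.
rewrite mulrBr divff // pnatr_eq0 -lt0n.
by apply/card_gt0P; exists (f e).
Qed.

Lemma density_L1_regular (a : V -> R) :
  \sum_e `|#|V|%:R * a (f e) - 1| = #|E|%:R * \sum_v `|a v - #|V|%:R^-1|.
Proof.
under eq_bigr do rewrite density_sub1 normrM normr_nat.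
rewrite (sum_comp_regular (fun v => #|V|%:R * `|a v - #|V|%:R^-1|)).
by rewrite -mulr_sumr mulrA card_regular_dom.
Qed.

Lemma density_L2_regular (a : V -> R) :
  \sum_e (#|V|%:R * a (f e) - 1) ^+ 2 =
  #|E|%:R * (#|V|%:R * \sum_v (a v - #|V|%:R^-1) ^+ 2).
Proof.
under eq_bigr do rewrite density_sub1 exprMn.
rewrite (sum_comp_regular (fun v => #|V|%:R ^+ 2 * (a v - #|V|%:R^-1) ^+ 2)).
by rewrite -mulr_sumr card_regular_dom; ring.
Qed.

End RegularMap.

Section NearUniform.
Variable R : realFieldType.

Definition near_uniform (V : finType) (eps1 eps2 : R) (a : V -> R) : Prop :=
  \sum_v `|a v - #|V|%:R^-1| <= eps1 /\
  \sum_v (a v - #|V|%:R^-1) ^+ 2 <= eps2 / #|V|%:R.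

Lemma near_uniform_density (E V : finType) (f : E -> V) (d : nat)
    (eps1 eps2 : R) (a : V -> R) :
  (forall v, #|[set e | f e == v]| = d) -> near_uniform eps1 eps2 a ->
  \sum_e `|#|V|%:R * a (f e) - 1| <= eps1 * #|E|%:R /\
  \sum_e (#|V|%:R * a (f e) - 1) ^+ 2 <= eps2 * #|E|%:R.
Proof.
move=> fd [a1 a2]; rewrite (density_L1_regular fd) (density_L2_regular fd).
rewrite !(mulrC _ #|E|%:R); split; first exact: ler_wpM2l.
have [V0|V0] := posnP #|V|.
  by rewrite (card_regular_dom R fd) V0 mulr0 !mul0r.
by rewrite ler_wpM2l // mulrC -ler_pdivlMr ?ltr0n.
Qed.

(* AM-GM on the product of the deviations [a - 1] and [b - 1]. *)
Lemma norm_mul_sub1_le (a b : R) :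
  `|a * b - 1| <=
  `|a - 1| + `|b - 1| + ((a - 1) ^+ 2 + (b - 1) ^+ 2) / 2.
Proof.
have -> : a * b - 1 = a - 1 + (b - 1) + (a - 1) * (b - 1) by ring.
apply: le_trans (ler_normD _ _) _; apply: lerD; first exact: ler_normD.
have := sqr_ge0 (`|a - 1| - `|b - 1|).
by rewrite sqrrB !real_normK ?num_real // normrM -mulr_natr; lra.
Qed.

Lemma biregular_density_close (E X Y : finType) (f : E -> X) (g : E -> Y)
    (dX dY : nat) (eps1 eps2 : R) (a : X -> R) (b : Y -> R) :
  (forall x, #|[set e | f e == x]| = dX) ->
  (forall y, #|[set e | g e == y]| = dY) ->
  near_uniform eps1 eps2 a -> near_uniform eps1 eps2 b ->
  \sum_e `|#|X|%:R * a (f e) * (#|Y|%:R * b (g e)) - 1| <=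
  (2 * eps1 + eps2) * #|E|%:R.
Proof.
move=> fX gY /(near_uniform_density fX)[a1 a2].
move=> /(near_uniform_density gY)[b1 b2].
apply: le_trans (ler_sum _ (fun e _ => norm_mul_sub1_le _ _)) _.
by rewrite !big_split /= -mulr_suml big_split /=; lra.
Qed.

End NearUniform.

Section Value.
Variables (R : realType) (X Y A B : finType).
Implicit Types (G : game X Y A B) (L : {ffun X -> A} * {ffun Y -> B}).

Definition success_rate G L : R := #|satisfied G L|%:R / #|edge G|%:R.

Lemma success_rateE G L :
  success_rate G L = wmean (fun=> 1) (fun e => (e \in satisfied G L)%:R).
Proof.
rewrite wmean_uniform -natr_sum; congr (_%:R / _).
by rewrite -sum1_card big_mkcond; apply: eq_bigr => e _; case: (e \in _).
Qed.

Lemma success_rate_le_val G L : success_rate G L <= game_val R G.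
Proof. exact: le_bigmax. Qed.

Lemma game_val_ge0 G : 0 <= game_val R G.
Proof. exact: bigmax_ge_id. Qed.

Lemma game_val_le G (c : R) :
  0 <= c -> (forall L, success_rate G L <= c) -> game_val R G <= c.
Proof. by move=> c0 rate_le; apply: bigmax_le => // L _; apply: rate_le. Qed.

Lemma success_rate_no_edge G L : #|edge G| = 0%N -> success_rate G L = 0.
Proof. by move=> E0; rewrite /success_rate E0 invr0 mulr0. Qed.

Definition mixed_success G (W Z : finType) (p : X -> W -> R) (q : Y -> Z -> R)
    (l : W -> X -> A) (m : Z -> Y -> B) (e : edge G) : R :=
  wmean (p (left_end e)) (fun w => wmean (q (right_end e)) (fun z =>
    ((l w (left_end e), m z (right_end e)) \in constraint e)%:R)).

Section MixedStrategy.
Variables (G : game X Y A B) (W Z : finType).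
Variables (p : X -> W -> R) (q : Y -> Z -> R).
Variables (l : W -> X -> A) (m : Z -> Y -> B).
Hypotheses (p_ge0 : forall x w, 0 <= p x w) (q_ge0 : forall y z, 0 <= q y z).

Lemma mixed_success_itv (e : edge G) : 0 <= mixed_success p q l m e <= 1.
Proof.
apply/andP; split; first by do 2!apply: wmean_ge0 => // ?.
by do 2!apply: wmean_le => // ?; rewrite lern1 leq_b1.
Qed.

Lemma mean_mixed_success_le_val (w0 : W) (z0 : Z) :
  wmean (fun=> 1) (@mixed_success G _ _ p q l m) <= game_val R G.
Proof.
have [c [d cd_best]] := pure_choice_pair (@left_end _ _ _ _ G)
  (@right_end _ _ _ _ G) w0 z0 p_ge0 q_ge0
  (F := fun e w z =>
    ((l w (left_end e), m z (right_end e)) \in constraint e)%:R)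
  (fun _ _ _ => ler0n R _).
pose L : {ffun X -> A} * {ffun Y -> B} :=
  ([ffun x => l (c x) x], [ffun y => m (d y) y]).
apply: le_trans (success_rate_le_val G L); rewrite success_rateE !wmean_uniform.
rewrite ler_wpM2r ?invr_ge0 //; apply: le_trans cd_best _.
by apply: ler_sum => e _; rewrite inE !ffunE.
Qed.

End MixedStrategy.
End Value.

Lemma sum_restrict (V : nmodType) (X Y A B : finType) (G : game X Y A B) S T
    (F : edge G -> V) :
  \sum_(t : edge (restrict G S T)) F (sval t) =
  \sum_(e | (left_end e \in S) && (right_end e \in T)) F e.
Proof.
by rewrite (big_sub (fun e => (left_end e \in S) && (right_end e \in T)) F).
Qed.

Lemma game_val_restrict_setT (R : realType) (X Y A B : finType)
    (G : game X Y A B) :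
  game_val R (restrict G [set: X] [set: Y]) = game_val R G.
Proof.
have val_bij : bijective (fun t : edge (restrict G setT setT) => sval t).
  exists (fun e => exist _ e (introT andP (conj (in_setT _) (in_setT _)))).
    by move=> t; apply: val_inj.
  by [].
apply: eq_bigr => L _; rewrite (bij_eq_card val_bij); congr (_%:R / _).
rewrite -(on_card_preimset (onW_bij _ val_bij)).
by apply: eq_card => t; rewrite !inE.
Qed.

Section NeighbourCount.
Variables (W X : finType) (H : {set W * X}) (D : nat).
Hypothesis regH : left_regular H D.

Definition back_nbrs (S : {set W}) (x : X) : {set W} :=
  [set w in S | (w, x) \in H].

Lemma nbr_distE (R : realType) (S : {set W}) (x : X) :
  nbr_dist R H S x = #|back_nbrs S x|%:R / (#|S| * D)%:R.
Proof.
rewrite /nbr_dist natrM invfM mulrCA -mulr_sumr; congr (_ * _).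
rewrite mulr_natl -sumr_const big_mkcond [RHS]big_mkcond /=.
by apply: eq_bigr => w _; rewrite !inE regH; case: (w \in S).
Qed.

Lemma nbr_dist_ge0 (R : realType) (S : {set W}) (x : X) :
  0 <= nbr_dist R H S x.
Proof. by rewrite nbr_distE divr_ge0. Qed.

Lemma back_nbrs_gt0 (S : {set W}) (x : X) :
  (0 < #|back_nbrs S x| -> 0 < #|S| * D)%N.
Proof.
move=> /card_gt0P[w]; rewrite inE => /andP[wS wx].
rewrite muln_gt0 -(regH w).
by apply/andP; split; apply/card_gt0P; [exists w | exists x; rewrite inE].
Qed.

End NeighbourCount.

Section Labels.
Variables (W X A : finType) (H : {set W * X}) (D : nat).
Hypothesis regH : left_regular H D.

Definition assigns (L : W -> D.-tuple A) (l : W -> X -> A) : Prop :=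
  forall w x (wx : (w, x) \in H), tnth (L w) (nbr_index regH wx) = l w x.

Definition unpack_labels (a0 : A) (L : W -> D.-tuple A) (w : W) (x : X) : A :=
  nth a0 (L w) (index x (enum (nbrs H w))).

Lemma assigns_unpack (a0 : A) (L : W -> D.-tuple A) :
  assigns L (unpack_labels a0 L).
Proof.
move=> w x wx; rewrite /unpack_labels (tnth_nth a0) /=.
by rewrite enum_rank_in.unlock insubdK // cardE [_ \in _]index_mem mem_enum inE.
Qed.

Definition pack_labels (L : X -> A) : {ffun W -> D.-tuple A} :=
  [ffun w => [tuple L (enum_val (cast_ord (esym (regH w)) i)) | i < D]].

Lemma assigns_pack (L : X -> A) : assigns (pack_labels L) (fun=> L).
Proof.
move=> w x wx; rewrite ffunE tnth_mktuple cast_ordK enum_rankK_in //.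
by rewrite inE.
Qed.

End Labels.

Section ConcatenatedGame.
Variables (R : realType) (X Y A B W Z : finType) (G : game X Y A B).
Variables (H1 : {set W * X}) (H2 : {set Z * Y}) (D1 D2 : nat).
Variables (reg1 : left_regular H1 D1) (reg2 : left_regular H2 D2).

Section Restriction.
Variables (S : {set W}) (T : {set Z}).

Let lefts (e : edge G) := back_nbrs H1 S (left_end e).
Let rights (e : edge G) := back_nbrs H2 T (right_end e).

Lemma sum_restrict_concat (V : nmodType) (F : W * edge G * Z -> V) :
  \sum_(t : edge (restrict (concat G reg1 reg2) S T)) F (sval (sval t)) =
  \sum_e \sum_(w in lefts e) \sum_(z in rights e) F (w, e, z).
Proof.
rewrite (sum_restrict (G := concat G reg1 reg2) _ _ (fun t => F (sval t))) /=.
rewrite -(big_sub_cond (fun t : W * edge G * Z =>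
  ((t.1.1, left_end t.1.2) \in H1) && ((t.2, right_end t.1.2) \in H2))
  (fun t => (t.1.1 \in S) && (t.2 \in T)) F).
under [RHS]eq_bigr => e _ do rewrite pair_big.
rewrite pair_big_dep.
rewrite [RHS](reindex (fun t : W * edge G * Z => (t.1.2, (t.1.1, t.2)))) /=.
  apply: eq_big => [[[w e] z]|[[w e] z] _] //=; rewrite !inE.
  by rewrite andbACA -andbA andbC andbA.
by exists (fun u => (u.2.1, u.1, u.2.2)) => [[[w e] z]|[e [w z]]].
Qed.

Definition edge_mult (e : edge G) : nat := #|lefts e| * #|rights e|.

Lemma card_edge_restrict_concat :
  #|edge (restrict (concat G reg1 reg2) S T)|%:R = \sum_e (edge_mult e)%:R :> R.
Proof.
rewrite -sum1_card natr_sum (sum_restrict_concat (fun=> 1%:R)).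
by apply: eq_bigr => e _; rewrite !sumr_const -mulrnA mulnC.
Qed.

Section Labelling.
Variables (L : {ffun W -> D1.-tuple A} * {ffun Z -> D2.-tuple B}).
Variables (l : W -> X -> A) (m : Z -> Y -> B).
Hypotheses (L1_assigns : assigns reg1 L.1 l)
  (L2_assigns : assigns reg2 L.2 m).

Lemma card_satisfied_restrict_concat :
  #|satisfied (restrict (concat G reg1 reg2) S T) L|%:R =
  \sum_e \sum_(w in lefts e) \sum_(z in rights e)
    ((l w (left_end e), m z (right_end e)) \in constraint e)%:R :> R.
Proof.
rewrite -(sum_restrict_concat (fun t : W * edge G * Z =>
  ((l t.1.1 (left_end t.1.2), m t.2 (right_end t.1.2))
    \in constraint t.1.2)%:R)).
rewrite -sum1_card natr_sum big_mkcond; apply: eq_bigr => t _.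
by rewrite !inE /= L1_assigns L2_assigns; case: ifP.
Qed.

Lemma success_rate_restrict_concat :
  success_rate R (restrict (concat G reg1 reg2) S T) L =
  wmean (fun e => (edge_mult e)%:R)
    (mixed_success (fun x => indic R (back_nbrs H1 S x))
                   (fun y => indic R (back_nbrs H2 T y)) l m).
Proof.
rewrite /success_rate card_satisfied_restrict_concat card_edge_restrict_concat.
congr (_ / _); apply: eq_bigr => e _.
rewrite natrM mulrAC card_mul_wmean_indic mulr_suml; apply: eq_bigr => w _.
by rewrite mulrC card_mul_wmean_indic.
Qed.

End Labelling.

Lemma success_rate_restrict_concat_pack
    (L : {ffun X -> A} * {ffun Y -> B}) :
  success_rate R (restrict (concat G reg1 reg2) S T)
    (pack_labels reg1 L.1, pack_labels reg2 L.2) =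
  wmean (fun e => (edge_mult e)%:R) (fun e => (e \in satisfied G L)%:R).
Proof.
rewrite /success_rate card_edge_restrict_concat.
rewrite (card_satisfied_restrict_concat (L := (_, _))
  (assigns_pack reg1 L.1) (assigns_pack reg2 L.2)).
congr (_ / _); apply: eq_bigr => e _.
by rewrite inE mulr_natl !sumr_const -mulrnA mulnC.
Qed.

Definition edge_density (e : edge G) : R :=
  #|X|%:R * nbr_dist R H1 S (left_end e) *
  (#|Y|%:R * nbr_dist R H2 T (right_end e)).

Lemma wmean_edge_mult (s : edge G -> R) :
  wmean (fun e => (edge_mult e)%:R) s = wmean edge_density s.
Proof.
pose k : R := #|X|%:R / (#|S| * D1)%:R * (#|Y|%:R / (#|T| * D2)%:R).
rewrite -(@wmean_scale _ _ k) => [|k0 e]; last first.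
  apply: contra_eq k0.
  rewrite pnatr_eq0 -lt0n muln_gt0 => /andP[lefts0 rights0].
  have X0 : (0 < #|X|)%N by apply/card_gt0P; exists (left_end e).
  have Y0 : (0 < #|Y|)%N by apply/card_gt0P; exists (right_end e).
  have S_nbrs := back_nbrs_gt0 reg1 lefts0.
  have T_nbrs := back_nbrs_gt0 reg2 rights0.
  by rewrite gt_eqF // mulr_gt0 // divr_gt0 ?ltr0n.
apply: eq_wmean => e.
rewrite /edge_mult natrM /edge_density (nbr_distE reg1) (nbr_distE reg2) /k.
ring.
Qed.

Hypothesis regG : biregular G.
Variables eps1 eps2 : R.
Hypotheses (eps1_ge0 : 0 <= eps1) (eps2_ge0 : 0 <= eps2).
Let deviation_ge0 : 0 <= 2 * eps1 + eps2.
Proof. by rewrite addr_ge0 // mulr_ge0. Qed.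

Hypothesis near_unif1 : near_uniform eps1 eps2 (nbr_dist R H1 S).
Hypothesis near_unif2 : near_uniform eps1 eps2 (nbr_dist R H2 T).

Lemma fortified_mean_close (s : edge G -> R) :
  (forall e, 0 <= s e <= 1) ->
  `|wmean (fun e => (edge_mult e)%:R) s - wmean (fun=> 1) s| <= 2 * eps1 + eps2.
Proof.
have [dX [dY [fX gY]]] := regG; move=> s01; rewrite wmean_edge_mult.
apply: wmean_close_uniform => // [e|].
  rewrite !mulr_ge0 //; first exact: (nbr_dist_ge0 reg1).
  exact: (nbr_dist_ge0 reg2).
exact: biregular_density_close fX gY near_unif1 near_unif2.
Qed.

Lemma game_val_restrict_concat_le :
  game_val R (restrict (concat G reg1 reg2) S T) <=
  game_val R G + (2 * eps1 + eps2).
Proof.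
have bound_ge0 : 0 <= game_val R G + (2 * eps1 + eps2).
  by rewrite addr_ge0 ?game_val_ge0.
apply: game_val_le => // L.
have [E0|] := posnP #|edge (restrict (concat G reg1 reg2) S T)|.
  by rewrite success_rate_no_edge.
case/card_gt0P=> t _; case: (sval t) => -[[w0 e0] z0] /= /andP[wx zy].
have L1_assigns := assigns_unpack reg1 (tnth (L.1 w0) (nbr_index reg1 wx)) L.1.
have L2_assigns := assigns_unpack reg2 (tnth (L.2 z0) (nbr_index reg2 zy)) L.2.
rewrite (success_rate_restrict_concat L1_assigns L2_assigns) addrC -lerBDr.
set s := mixed_success _ _ _ _.
have s01 e : 0 <= s e <= 1 by apply: mixed_success_itv => *; apply: indic_ge0.
apply: le_trans (le_trans (ler_norm _) (fortified_mean_close s01)).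
rewrite lerD2l lerN2.
by apply: (mean_mixed_success_le_val _ _ _ _ _ w0 z0) => *; apply: indic_ge0.
Qed.

Lemma game_val_le_restrict_concat :
  game_val R G <=
  game_val R (restrict (concat G reg1 reg2) S T) + (2 * eps1 + eps2).
Proof.
apply: game_val_le => [|L].
  by rewrite addr_ge0 ?game_val_ge0.
have pack_le := success_rate_le_val R (restrict (concat G reg1 reg2) S T)
  (pack_labels reg1 L.1, pack_labels reg2 L.2).
rewrite -lerBlDl; apply: le_trans (lerB (lexx _) pack_le) _.
rewrite success_rate_restrict_concat_pack success_rateE.
rewrite (le_trans (ler_norm _)) // distrC fortified_mean_close // => e.
by rewrite ler0n lern1 leq_b1.
Qed.

End Restriction.

Lemma concat_robust (delta eps1 eps2 : R) :
  biregular G -> 0 <= eps1 -> 0 <= eps2 ->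
  fortifier delta eps1 eps2 H1 -> fortifier delta eps1 eps2 H2 ->
  robust delta (2 * (2 * eps1 + eps2)) (concat G reg1 reg2).
Proof.
move=> regG eps1_ge0 eps2_ge0 fort1 fort2 S T Sbig Tbig.
have big_setT (V : finType) (U : {set V}) :
    delta * #|V|%:R <= #|U|%:R -> delta * #|V|%:R <= #|[set: V]|%:R.
  by move/le_trans; apply; rewrite ler_nat subset_leq_card ?subsetT.
have upper := game_val_restrict_concat_le regG eps1_ge0 eps2_ge0
  (fort1 _ Sbig) (fort2 _ Tbig).
have := game_val_le_restrict_concat regG eps1_ge0 eps2_ge0
  (fort1 _ (big_setT _ _ Sbig)) (fort2 _ (big_setT _ _ Tbig)).
rewrite game_val_restrict_setT; lra.
Qed.

End ConcatenatedGame.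

Theorem mainTheorem1 (R : realType) :
  exists C : R, 0 < C /\
    forall (X Y A B W Z : finType) (G : game X Y A B) (eps delta : R)
      (H1 : {set W * X}) (H2 : {set Z * Y}) (D1 D2 : nat)
      (reg1 : left_regular H1 D1) (reg2 : left_regular H2 D2),
      biregular G -> 0 < eps -> 0 < delta ->
      fortifier delta eps eps H1 -> fortifier delta eps eps H2 ->
      robust delta (C * eps) (concat G reg1 reg2).
Proof.
exists 6; split=> // X Y A B W Z G eps delta H1 H2 D1 D2 reg1 reg2.
move=> regG eps_gt0 _ fort1 fort2.
have -> : 6 * eps = 2 * (2 * eps + eps) by ring.
exact: concat_robust (ltW eps_gt0) (ltW eps_gt0) fort1 fort2.
Qed.
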